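(* Let $H$ be a connected graph on $k\geq 2$ vertices. Let $(\lambda_n)_{n\geq 1}$ be a sequence of positive real numbers with $\lambda_n\rightarrow \lambda$ as $n\rightarrow\infty$, where $\lambda>0$. Let $q=q(n)$ be the unique positive solution $x$ of the equation $P(H,x)=\lambda_n^{1/n}$, where $P(H,x)=\sum_i\alpha_{i,H}x^i$ and $\alpha_{i,H}$ is the number of vertices of degree $i$ in $H$. If $p=p(n)=1-q$ (which lies in $(0,1)$ for all sufficiently large $n$), then $$\lim_{n\rightarrow \infty}\mathbb{P}[(H^n)_p \text{ is connected}]=\exp(-\lambda).$$
   Context: All graphs are finite and simple. For a graph $H$, the $n$-th Cartesian power $H^n$ has vertex set $V(H)\times\cdots\times V(H)$ ($n$ factors), and two vertices $(v_1,\ldots,v_n)$ and $(w_1,\ldots,w_n)$ are adjacent if and only if there is an $i\in\{1,\ldots,n\}$ such that $v_j=w_j$ for all $j\neq i$ and $v_iw_i\in E(H)$. For a graph $F$ and $p\in(0,1)$, $F_p$ denotes the random graph on the vertex set of $F$ obtained from $F$ by deleting every edge independently with probability $1-p$. *)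

(* Defs.v *)
From HB Require Import structures.
From mathcomp Require Import all_boot all_order all_algebra.
From mathcomp Require Import reals.

Set Implicit Arguments.
Unset Strict Implicit.
Unset Printing Implicit Defensive.

Import Order.TTheory GRing.Theory Num.Theory.
Local Open Scope ring_scope.

Record sgraph (V : finType) := SGraph {
  adj :> rel V;
  adj_sym : symmetric adj;
  adj_irrefl : irreflexive adj }.

Section Graphs.
Variables (V : finType) (G : sgraph V).

Definition connected_graph : bool := [forall x, forall y, connect G x y].

Definition degree (v : V) : nat := #|[set w | G v w]|.

Definition edges : {set {set V}} := [set [set z.1; z.2] | z : V * V & G z.1 z.2].

Section Spanning.
Variable A : {set {set V}}.

Definition spanning_rel : rel V := fun x y => G x y && ([set x; y] \in A).

Lemma spanning_sym : symmetric spanning_rel.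
Proof. by move=> x y; rewrite /spanning_rel adj_sym setUC. Qed.

Lemma spanning_irrefl : irreflexive spanning_rel.
Proof. by move=> x; rewrite /spanning_rel adj_irrefl. Qed.

Definition spanning_subgraph : sgraph V := SGraph spanning_sym spanning_irrefl.
End Spanning.
End Graphs.

Section CartesianPower.
Variables (T : finType) (H : sgraph T) (n : nat).

Definition cart_rel : rel {ffun 'I_n -> T} := fun v w =>
  [exists i, [forall j, (j != i) ==> (v j == w j)] && H (v i) (w i)].

Lemma cart_sym : symmetric cart_rel.
Proof.
move=> v w; apply: eq_existsb => i; rewrite adj_sym; congr (_ && _).
by apply: eq_forallb => j; rewrite (eq_sym (v j)).
Qed.

Lemma cart_irrefl : irreflexive cart_rel.
Proof.
by move=> v; apply/negbTE/existsPn => i; rewrite adj_irrefl andbF.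
Qed.

Definition cart_pow : sgraph {ffun 'I_n -> T} := SGraph cart_sym cart_irrefl.
End CartesianPower.

Section Percolation.
Variables (R : realType) (V : finType) (G : sgraph V) (p : R).

(* Probability that the set of retained edges is exactly A (for A \subset
   edges G), each edge being retained independently with probability p. *)
Definition edge_weight (A : {set {set V}}) : R :=
  \prod_(e in edges G) (if e \in A then p else 1 - p).

(* P[G_p satisfies Q].  For p outside [0, 1] this is merely a polynomial
   in p. *)
Definition perc_prob (Q : pred (sgraph V)) : R :=
  \sum_(A in powerset (edges G) | Q (spanning_subgraph G A)) edge_weight A.

Lemma perc_prob_total : perc_prob predT = 1.
Proof.
rewrite /perc_prob /edge_weight.
pose F (e : {set V}) : R := if e \in edges G then p else 0.
pose K (e : {set V}) : R := if e \in edges G then 1 - p else 1.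
transitivity (\sum_(A in {set {set V}}) \prod_e (if e \in A then F e else K e)); last first.
  rewrite -[LHS](@bigA_distr R 0 1 *%R +%R) big1 // => e _.
  by rewrite /F /K; case: ifP => _; rewrite /= ?add0r // addrC subrK.
rewrite [RHS](bigID (mem (powerset (edges G)))) /=.
rewrite [X in _ = _ + X]big1 ?addr0 => [|A]; last first.
  rewrite powersetE => /subsetPn[e eA eG].
  by rewrite (bigD1 e) //= eA /F (negPf eG) mul0r.
apply: eq_big => [A|A]; first by rewrite andbT.
rewrite powersetE andbT => /subsetP sAG.
rewrite [RHS](bigID (mem (edges G))) /= [X in _ = _ * X]big1 ?mulr1 => [|e eG].
  by apply: eq_bigr => e eG; rewrite /F /K eG.
rewrite /K (negPf eG); case: ifP => // /sAG eG'.
by rewrite eG' in eG.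
Qed.
End Percolation.

Definition ndeg (V : finType) (G : sgraph V) (i : nat) : nat :=
  #|[set v | degree G v == i]|.

(* P(G, x); degrees in a simple graph are less than the number of vertices. *)
Definition deg_poly (R : realType) (V : finType) (G : sgraph V) (x : R) : R :=
  \sum_(i < #|V|) (ndeg G i)%:R * x ^+ i.

(* Main.v *)
Require Import Defs.
From HB Require Import structures.
From mathcomp Require Import all_boot all_order all_algebra.
From mathcomp Require Import reals.
From mathcomp Require Import ring lra zify.

Set Implicit Arguments.
Unset Strict Implicit.
Unset Printing Implicit Defensive.

Import Order.TTheory GRing.Theory Num.Theory.
Local Open Scope ring_scope.

(** Write q = 1 - p and k for the number of vertices of H.  A vertex v of H^n
is isolated with probability q^(deg v).  Degrees in H^n add up over the
coordinates, so the sum of these probabilities factorises and the expected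
number of isolated vertices is exactly P(H, q)^n, which is lambda_n.  The
theorem follows from two facts: the number of isolated vertices is
asymptotically Poisson, and isolated vertices are asymptotically the only
obstruction to connectivity.

Poisson limit.  The expected number of r-element sets of isolated vertices is
S_r, the sum over such sets B of q^t(B), where t(B) counts the edges that meet
B.  Adding a vertex v to B multiplies the term by q^(deg v), unless v is within
distance one of B; the exceptional v are few and have weight at most q^(n - r).
Hence (r + 1) S_(r+1) = lambda_n S_r + o(1) ([isolation_sum_step]) and S_r tends
to lambda^r / r!.  The Bonferroni inequalities ([prob_no_isolated]) turn this
into the convergence of the probability that no vertex is isolated.

Only isolated vertices matter.  Call a vertex rich if open edges leave it in at
least 2 (a + 1) coordinate directions, where a is a small fraction of n, and
poor otherwise.

- With high probability no two adjacent vertices are both poor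
  ([prob_has_poor_pair]).  The probability that v is poor is q^(deg v) up to a
  factor exp(eps n), where eps is small when a / n is.  The numbers q^(deg v) sum
  to lambda_n, and requiring a second poor vertex next to v brings an additional
  factor of about q^n, which outweighs the loss.

- With high probability any two rich vertices u, v at distance at most two are
  joined by an open path ([prob_has_unlinked]).  Pick open directions i at u and
  j at v.  Moving in direction i and then j from u, walking parallel to a path
  from u to v, and undoing the moves in the same order gives a path from u to v
  whose end edges are the two open ones.  It has at most four other edges, and
  these are different for different pairs (i, j) if i and j are taken from
  disjoint sets.  So about a^2 independent attempts have to fail, which has
  probability exp(- c n^2).  This beats any number exp(O(n)) of choices, so that
  a crude union bound over everything suffices.

If neither defect occurs and no vertex is isolated, the graph is connected
([connected_from_good]): along a path of H^n two consecutive vertices are never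
both poor, so all rich vertices are linked together, and a poor vertex has an
open edge, whose other end is rich.

As P(H, .) increases from P(H, 0) = 0 through P(H, 1) = k to infinity, the
solution q exists and is unique.  For large n it stays below some s1 < s0 < 1 with
s0 P(H, s0) < 1 ([deg_poly_window]); the last inequality is what makes poor pairs
rare. *)

(** * Expectations in percolation *)

Section Expectation.
Variables (R : realType) (V : finType) (G : sgraph V) (p : R).

Definition expect (f : {set {set V}} -> R) : R :=
  \sum_(A in powerset (edges G)) edge_weight G p A * f A.

Definition prob (Q : pred {set {set V}}) : R := expect (fun A => (Q A)%:R).

Lemma perc_probE (Q : pred (sgraph V)) :
  perc_prob G p Q = prob (fun A => Q (spanning_subgraph G A)).
Proof.
rewrite /perc_prob big_mkcondr /=; apply: eq_bigr => A _.
by case: (Q _); rewrite ?mulr1 ?mulr0.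
Qed.

Lemma eq_expect f g : f =1 g -> expect f = expect g.
Proof. by move=> fg; apply: eq_bigr => A _; rewrite fg. Qed.

Lemma expectB f g : expect (fun A => f A - g A) = expect f - expect g.
Proof. by rewrite -sumrB; apply: eq_bigr => A _; rewrite mulrBr. Qed.

Lemma expectZ c f : expect (fun A => c * f A) = c * expect f.
Proof. by rewrite mulr_sumr; apply: eq_bigr => A _; rewrite mulrCA. Qed.

Lemma expect_sum (I : finType) (P : pred I) (f : I -> {set {set V}} -> R) :
  expect (fun A => \sum_(i | P i) f i A) = \sum_(i | P i) expect (f i).
Proof.
by rewrite /expect exchange_big; apply: eq_bigr => A _; rewrite mulr_sumr.
Qed.

(** Every probability below is computed from this one: the edges are independent,
so the expectation of a product of functions of single edges factorises. *)
Lemma expect_prod (x y : {set V} -> R) :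
  expect (fun A => \prod_(e in edges G) (if e \in A then x e else y e)) =
  \prod_(e in edges G) (p * x e + (1 - p) * y e).
Proof.
(* Extended by 0 and 1 off the edge set, the product runs over all sets of
   vertices, and distributing it produces one term for each set of retained edges. *)
pose F e : R := if e \in edges G then p * x e else 0.
pose K e : R := if e \in edges G then (1 - p) * y e else 1.
transitivity (\prod_e (F e + K e)); last first.
  rewrite [LHS](bigID (mem (edges G))) /= [X in _ * X]big1 ?mulr1.
    by apply: eq_bigr => e eG; rewrite /F /K eG.
  by move=> e eG; rewrite /F /K (negPf eG) add0r.
rewrite bigA_distr /= [RHS](bigID (mem (powerset (edges G)))) /=.
rewrite [X in _ = _ + X]big1 ?addr0 => [|A]; last first.
  rewrite powersetE => /subsetPn[e eA eG].
  by rewrite (bigD1 e) //= eA /F (negPf eG) mul0r.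
apply: eq_bigr => A; rewrite powersetE => /subsetP sAG.
rewrite [RHS](bigID (mem (edges G))) /= [X in _ = _ * X]big1 ?mulr1; last first.
  move=> e eG; rewrite /K (negPf eG); case: ifP => // /sAG eG'.
  by rewrite eG' in eG.
rewrite /edge_weight -big_split /=; apply: eq_bigr => e eG.
by rewrite /F /K eG; case: ifP.
Qed.

Lemma natr_forall_in (B : {set {set V}}) (P : pred {set V}) :
  ([forall e in B, P e]%:R : R) = \prod_(e in B) (P e)%:R.
Proof.
case: (boolP [forall e in B, P e]) => [/forall_inP PB|].
  by rewrite big1 // => e /PB ->.
by rewrite negb_forall_in => /exists_inP[e eB /negPf Pe]; rewrite (bigD1 e) //= Pe mul0r.
Qed.

Lemma prod_sub (B C : {set {set V}}) (F : {set V} -> R) : B \subset C ->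
  \prod_(e in C) (if e \in B then F e else 1) = \prod_(e in B) F e.
Proof.
move=> sBC; rewrite -big_mkcondr /=; apply: eq_bigl => e.
by rewrite andb_idl //; exact: (subsetP sBC).
Qed.

Lemma prob_closed (B : {set {set V}}) : B \subset edges G ->
  prob (fun A => [disjoint B & A]) = (1 - p) ^+ #|B|.
Proof.
move=> sBG; rewrite -prodr_const -(prod_sub _ sBG).
transitivity (\prod_(e in edges G) (p * (e \notin B)%:R + (1 - p) * 1)); last first.
  by apply: eq_bigr => e _; case: (e \in B); rewrite /=; ring.
rewrite -expect_prod; apply: eq_expect => A.
rewrite (eq_bigr (fun e => if e \in B then (e \notin A)%:R else 1)); last first.
  by move=> e _; case: (e \in A); case: (e \in B).
rewrite (prod_sub _ sBG) -natr_forall_in; congr (_ %:R).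
rewrite disjoint_subset; congr nat_of_bool.
by apply/subsetP/forall_inP => h e /h.
Qed.

Lemma prob_open (B : {set {set V}}) : B \subset edges G ->
  prob (fun A => B \subset A) = p ^+ #|B|.
Proof.
move=> sBG; rewrite -prodr_const -(prod_sub _ sBG).
transitivity (\prod_(e in edges G) (p * 1 + (1 - p) * (e \notin B)%:R)); last first.
  by apply: eq_bigr => e _; case: (e \in B); rewrite /=; ring.
rewrite -expect_prod; apply: eq_expect => A.
rewrite (eq_bigr (fun e => if e \in B then (e \in A)%:R else 1)); last first.
  by move=> e _; case: (e \in A); case: (e \in B).
rewrite (prod_sub _ sBG) -natr_forall_in; congr (_ %:R); congr nat_of_bool.
by apply/subsetP/forall_inP => h e /h.
Qed.

(** Families of disjoint edge sets are independent.  The event that C is open is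
carried along for the induction: splitting off the block i writes the
expectation as a difference of two instances for the shorter list, one with C
and one with the union of C and B i. *)
Lemma prob_open_blocks (I : eqType) (s : seq I) (B : I -> {set {set V}})
    (C : {set {set V}}) :
  uniq s -> C \subset edges G -> {in s, forall i, B i \subset edges G} ->
  {in s, forall i, [disjoint C & B i]} ->
  {in s &, forall i j, i != j -> [disjoint B i & B j]} ->
  expect (fun A => (C \subset A)%:R * \prod_(i <- s) (~~ (B i \subset A))%:R) =
  p ^+ #|C| * \prod_(i <- s) (1 - p ^+ #|B i|).
Proof.
elim: s C => [|i s IHs] C /=.
  move=> _ sC _ _ _; rewrite big_nil mulr1 -prob_open //.
  by apply: eq_expect => A; rewrite big_nil mulr1.
move=> /andP[nis us] sC sB dC dB.
have sBi : B i \subset edges G by apply: sB; rewrite mem_head.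
have dCi : [disjoint C & B i] by apply: dC; rewrite mem_head.
have in_s j : j \in s -> j \in i :: s by rewrite inE orbC => ->.
rewrite (eq_expect (g := fun A =>
   (C \subset A)%:R * \prod_(j <- s) (~~ (B j \subset A))%:R
   - ((C :|: B i) \subset A)%:R * \prod_(j <- s) (~~ (B j \subset A))%:R)); last first.
  move=> A; rewrite big_cons subUset mulrA -mulrBl; congr (_ * _).
  by case: (C \subset A); case: (B i \subset A); rewrite /=; ring.
rewrite expectB !IHs //; first 1 last.
- by rewrite subUset sC.
- by move=> j /in_s; exact: sB.
- move=> j js; rewrite -setI_eq0 setIUl setU_eq0 !setI_eq0 dC ?in_s // dB ?mem_head ?in_s //.
  by apply: contraNneq nis => ->.
- by move=> j k js ks; apply: dB; exact: in_s.
- by move=> j /in_s; exact: sB.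
- by move=> j /in_s; exact: dC.
- by move=> j k js ks; apply: dB; exact: in_s.
have -> : #|C :|: B i| = (#|C| + #|B i|)%N.
  by apply/eqP; rewrite (leq_card_setU C (B i)).2.
by rewrite big_cons exprD mulrBl mul1r mulrBr !mulrA.
Qed.

Hypothesis p01 : 0 <= p <= 1.

Lemma edge_weight_ge0 A : 0 <= edge_weight G p A.
Proof.
by move: p01 => /andP[p0 p1]; apply: prodr_ge0 => e _; case: ifP; rewrite ?subr_ge0.
Qed.

Lemma le_expect f g : (forall A, f A <= g A) -> expect f <= expect g.
Proof. by move=> fg; apply: ler_sum => A _; rewrite ler_wpM2l ?edge_weight_ge0. Qed.

Lemma prob_ge0 Q : 0 <= prob Q.
Proof. by apply: sumr_ge0 => A _; rewrite mulr_ge0 ?edge_weight_ge0. Qed.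

Lemma le_prob (Q Q' : pred {set {set V}}) :
  (forall A, Q A -> Q' A) -> prob Q <= prob Q'.
Proof.
by move=> QQ'; apply: le_expect => A; rewrite ler_nat; case: (Q A) (QQ' A) => // ->.
Qed.

Lemma prob_exists (I : finType) (P : pred I) (Q : I -> pred {set {set V}}) :
  prob (fun A => [exists i, P i && Q i A]) <= \sum_(i | P i) prob (Q i).
Proof.
rewrite -expect_sum; apply: le_expect => A.
case: existsP => [[i /andP[Pi QiA]]|_]; last by rewrite sumr_ge0.
by rewrite (bigD1 i) //= QiA lerDl sumr_ge0.
Qed.

(** Markov's inequality for theta^(number of open edges of B), in Chernoff's
manner. *)
Lemma prob_few_open (B : {set {set V}}) (theta : R) (m : nat) :
  B \subset edges G -> 0 < theta <= 1 ->
  prob (fun A => #|B :&: A| <= m)%N <=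
  theta^-1 ^+ m * (1 - p + p * theta) ^+ #|B|.
Proof.
move=> sBG /andP[t0 t1].
have -> : (1 - p + p * theta) ^+ #|B| = expect (fun A => theta ^+ #|B :&: A|).
  rewrite -prodr_const -(prod_sub _ sBG).
  transitivity (\prod_(e in edges G) (p * (if e \in B then theta else 1) + (1 - p) * 1)).
    by apply: eq_bigr => e _; case: (e \in B); rewrite /=; ring.
  rewrite -expect_prod; apply: eq_expect => A.
  rewrite (eq_bigr (fun e => if e \in B then (if e \in A then theta else 1) else 1)); last first.
    by move=> e _; case: (e \in A); case: (e \in B).
  rewrite (prod_sub _ sBG) -big_mkcondr /= -prodr_const; apply: eq_bigl => e.
  by rewrite inE.
rewrite -expectZ; apply: le_expect => A; case: leqP => hm; last first.
  by rewrite mulr_ge0 ?exprn_ge0 ?invr_ge0 // ltW.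
rewrite exprVn ler_pdivlMl ?exprn_gt0 // mulr1.
exact: ler_wiXn2l (ltW t0) t1 _ _ hm.
Qed.

End Expectation.

(** * Stars and isolated vertices *)

Section Stars.
Variables (V : finType) (G : sgraph V).

Lemma adj_neq x y : G x y -> x != y.
Proof. by apply: contraTneq => ->; rewrite adj_irrefl. Qed.

Lemma edgesP (e : {set V}) :
  reflect (exists x y, G x y /\ e = [set x; y]) (e \in edges G).
Proof.
apply: (iffP imsetP) => [[[x y]]|[x [y [Gxy ->]]]]; last by exists (x, y); rewrite ?inE.
by rewrite inE => Gxy ->; exists x, y.
Qed.

Lemma edges_pair x y : ([set x; y] \in edges G) = G x y.
Proof.
apply/edgesP/idP => [[a [b [Gab eq_e]]]|Gxy]; last by exists x, y.
have : x \in [set a; b] by rewrite -eq_e set21.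
have : y \in [set a; b] by rewrite -eq_e set22.
have : a \in [set x; y] by rewrite eq_e set21.
have : b \in [set x; y] by rewrite eq_e set22.
move: (adj_neq Gab); rewrite !inE => neq.
move=> /orP[]/eqP eb /orP[]/eqP ea _ _; move: Gab neq; rewrite ea eb ?eqxx //.
by move=> Gyx _; rewrite adj_sym.
Qed.

Definition star v : {set {set V}} := [set e in edges G | v \in e].

Lemma star_edges v : star v \subset edges G.
Proof. by apply/subsetP => e; rewrite inE => /andP[]. Qed.

Lemma starE v : star v = [set [set v; w] | w in [set w | G v w]].
Proof.
apply/setP => e; rewrite inE; apply/andP/imsetP => [[/edgesP[x [y [Gxy ->]]]]|].
  rewrite !inE => /orP[]/eqP ->; first by exists y; rewrite ?inE.
  by exists x; rewrite ?inE 1?adj_sym // setUC.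
by move=> [w]; rewrite inE => Gvw ->; rewrite edges_pair set21.
Qed.

Lemma card_star v : #|star v| = degree G v.
Proof.
rewrite starE card_in_imset // => w w'; rewrite !inE => Gw Gw' eq_e.
have : w \in [set v; w'] by rewrite -eq_e set22.
by rewrite !inE eq_sym (negPf (adj_neq Gw)) => /eqP.
Qed.

Lemma star_pair v w e : v != w -> e \in star v -> w \in e -> e = [set v; w].
Proof.
rewrite starE => vw /imsetP[x _ ->]; rewrite !inE eq_sym (negPf vw) /=.
by move=> /eqP ->.
Qed.

(** Two stars share at most the edge joining their centres. *)
Lemma card_starU u v : u != v ->
  ((degree G u + degree G v).-1 <= #|star u :|: star v|)%N.
Proof.
move=> uv; rewrite -!card_star -cardsUI -subn1 leq_subLR addnC leq_add2r.
rewrite -(cards1 [set u; v]) subset_leq_card //; apply/subsetP => e.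
rewrite in_setI in_set1 => /andP[eu]; rewrite inE => /andP[_ ve].
by apply/eqP/star_pair.
Qed.

Definition touching (B : {set V}) := \bigcup_(v in B) star v.

Lemma touching_edges B : touching B \subset edges G.
Proof. by apply/bigcupsP => v _; exact: star_edges. Qed.

Lemma touchingU1 v (B : {set V}) : touching (v |: B) = star v :|: touching B.
Proof. by rewrite /touching bigcup_setU big_set1. Qed.

(** An edge at v that also meets B joins v to an element of B, and so is
determined by that element. *)
Lemma card_starI_touching v (B : {set V}) : v \notin B -> (#|star v :&: touching B| <= #|B|)%N.
Proof.
move=> vB; apply: leq_trans (leq_imset_card (fun u => [set v; u]) (mem B)).
apply: subset_leq_card; apply/subsetP => e; rewrite inE => /andP[ev /bigcupP[u uB]].
rewrite inE => /andP[_ ue]; apply/imsetP; exists u => //; apply: star_pair => //.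
by apply: contraNneq vB => ->.
Qed.

Lemma disjoint_star_touching v (B : {set V}) : v \notin B :|: \bigcup_(u in B) [set w | G u w] ->
  [disjoint star v & touching B].
Proof.
rewrite inE negb_or => /andP[vB /bigcupP vN]; rewrite -setI_eq0.
apply/eqP/setP => e; rewrite in_set0 in_setI; apply/negP => /andP[ev /bigcupP[u uB]].
rewrite inE => /andP[eE ue]; case: vN; exists u => //; rewrite inE.
rewrite adj_sym -edges_pair -(star_pair _ ev ue) //.
by apply: contraNneq vB => ->.
Qed.

Lemma card_closed_nbhd (D : nat) (B : {set V}) : (forall v, degree G v <= D)%N ->
  (#|B :|: \bigcup_(u in B) [set w | G u w]| <= #|B| + #|B| * D)%N.
Proof.
move=> degD; apply: leq_trans (leq_card_setU _ _) _; rewrite leq_add2l.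
rewrite -sum_nat_const; elim/big_rec2: _ => [|v m A _ hm]; first by rewrite cards0.
by apply: leq_trans (leq_card_setU _ _) _; rewrite leq_add ?degD.
Qed.

Definition isolated_set (A : {set {set V}}) : {set V} := [set v | [disjoint star v & A]].

Lemma sub_isolated A (B : {set V}) : (B \subset isolated_set A) = [disjoint touching B & A].
Proof.
rewrite disjoint_sym; apply/subsetP/bigcup_disjointP => h v /h; first by rewrite inE disjoint_sym.
by rewrite inE disjoint_sym.
Qed.

Lemma isolatedPn A v : v \notin isolated_set A ->
  exists2 w, G v w & spanning_subgraph G A v w.
Proof.
rewrite inE -setI_eq0 => /set0Pn[e /setIP[]]; rewrite starE => /imsetP[w].
by rewrite inE => Gvw -> eA; exists w; rewrite //= /spanning_rel Gvw.
Qed.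
End Stars.

(** Each C with r + 1 elements arises as v |: B from r + 1 pairs, one for each v in C. *)
Lemma sum_add_vertex (R : realType) (V : finType) (f : {set V} -> R) r :
  \sum_(B : {set V} | #|B| == r) \sum_(v | v \notin B) f (v |: B) =
  r.+1%:R * \sum_(B : {set V} | #|B| == r.+1) f B.
Proof.
rewrite (exchange_big_dep predT) //= mulr_sumr.
transitivity (\sum_v \sum_(C : {set V} | (#|C| == r.+1) && (v \in C)) f C).
  apply: eq_bigr => v _.
  rewrite [RHS](reindex_onto (fun B => v |: B) (fun C => C :\ v)) /=; last first.
    by move=> C /andP[_ vC]; rewrite setD1K.
  apply: eq_bigl => B; rewrite setU11 andbT cardsU1.
  have [vB|vB] /= := boolP (v \in B); last by rewrite setU1K // eqxx andbT.
  rewrite andbF; apply/esym/negbTE; rewrite negb_and; apply/orP; right.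
  by apply: contraTneq vB => <-; rewrite setD11.
rewrite (exchange_big_dep (fun C : {set V} => #|C| == r.+1)) /=; last by move=> v C _ /andP[].
apply: eq_bigr => C /eqP cC.
rewrite (eq_bigl (mem C)); last by move=> v; rewrite cC eqxx.
by rewrite sumr_const cC mulr_natl.
Qed.

Section FactorialMoments.
Variables (R : realType) (V : finType) (G : sgraph V).

(** The expected number of r-element sets of isolated vertices when edges are
closed with probability q, see [expect_binomial_isolated]. *)
Definition isolation_sum (q : R) (r : nat) : R :=
  \sum_(B : {set V} | #|B| == r) q ^+ #|touching G B|.

Lemma isolation_sum0 q : isolation_sum q 0 = 1.
Proof.
rewrite /isolation_sum (big_pred1 set0) => [|B]; last exact: cards_eq0.
by rewrite /touching big_set0 cards0.
Qed.

Lemma expect_binomial_isolated p r :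
  expect G p (fun A => 'C(#|isolated_set G A|, r)%:R) = isolation_sum (1 - p) r.
Proof.
rewrite /isolation_sum -(eq_bigr _ (fun B _ => prob_closed p (touching_edges G B))).
rewrite -expect_sum; apply: eq_expect => A.
rewrite -cards_draws -sum1_card natr_sum.
rewrite (eq_bigl (fun B : {set V} => (#|B| == r) && (B \subset isolated_set G A))); last first.
  by move=> B; rewrite inE andbC.
by rewrite big_mkcondr /=; apply: eq_bigr => B _; rewrite sub_isolated; case: ifP.
Qed.

(** If v is at distance at least two from B, the star of v is disjoint from the
edges meeting B, and v contributes q^(deg v) times the term of B, which is also its
share of the subtracted product.  The remaining v lie in the closed neighbourhood
of B.  For each of them both contributions, relative to the term of B, lie between
0 and q^(d - r), because at most r edges at a vertex outside B meet B. *)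
Lemma isolation_sum_step (q : R) (d D r : nat) :
  0 <= q <= 1 -> (forall v, d <= degree G v <= D)%N ->
  `|r.+1%:R * isolation_sum q r.+1 - (\sum_v q ^+ degree G v) * isolation_sum q r|
  <= isolation_sum q r * ((r + r * D)%:R * q ^+ (d - r)).
Proof.
move=> /andP[q0 q1] degG.
rewrite /isolation_sum -sum_add_vertex mulr_sumr -sumrB mulr_suml.
apply: le_trans (ler_norm_sum _ _ _) _; apply: ler_sum => B /eqP cB.
have tU v : q ^+ #|touching G (v |: B)| =
    q ^+ #|touching G B| * q ^+ #|star G v :\: touching G B|.
  rewrite -exprD touchingU1 -(cardsID (touching G B) (_ :|: _)).
  by rewrite setIC setKU setDUl setDv setU0.
rewrite (eq_bigr _ (fun v _ => tU v)) -mulr_sumr [X in _ - X]mulrC -mulrBr normrM.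
rewrite ger0_norm ?exprn_ge0 // ler_wpM2l ?exprn_ge0 //.
set Z := B :|: \bigcup_(u in B) [set w | G u w].
rewrite big_mkcond -sumrB; apply: le_trans (ler_norm_sum _ _ _) _.
apply: (@le_trans _ _ (\sum_(v in Z) q ^+ (d - r))); last first.
  rewrite sumr_const -[leLHS]mulr_natl ler_wpM2r ?exprn_ge0 // ler_nat -cB.
  by apply: card_closed_nbhd => v; case/andP: (degG v).
rewrite [leRHS]big_mkcond; apply: ler_sum => v _.
have bnd m : (d - r <= m)%N -> 0 <= q ^+ m <= q ^+ (d - r).
  by move=> hm; rewrite exprn_ge0 //= ler_wiXn2l.
have degv : (d <= degree G v)%N by case/andP: (degG v).
have /andP[b0 b1] := bnd _ (leq_trans (leq_subr r d) degv).
have b2 : (v \notin B) -> 0 <= q ^+ #|star G v :\: touching G B| <= q ^+ (d - r).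
  move=> vB; apply: bnd; rewrite cardsD card_star leq_sub // -cB.
  exact: card_starI_touching.
case: ifPn => vB; case: ifPn => vZ.
- have /andP[c0 c1] := b2 vB; rewrite ler_norml lerBrDr lerBlDr.
  rewrite (le_trans _ c0) ?(le_trans c1) ?lerDl //.
  by rewrite addrC subr_le0.
- have /setDidPl -> := disjoint_star_touching vZ.
  by rewrite card_star subrr normr0.
- by rewrite sub0r normrN ger0_norm.
- by move: vZ; rewrite inE negb_or (negPf vB).
Qed.

(** The truncated inclusion-exclusion sum telescopes by Pascal's rule. *)
Lemma alternating_binomial (n m : nat) :
  \sum_(r < m.+1) (-1) ^+ r * 'C(n.+1, r)%:R = (-1) ^+ m * 'C(n, m)%:R :> R.
Proof.
elim: m => [|m IHm]; first by rewrite big_ord1 !bin0.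
by rewrite big_ord_recr /= IHm binS natrD exprS mulrDr !mulN1r !mulNr addrCA subrr addr0.
Qed.

(** For positive n and m the truncated sum is, up to sign, C(n - 1, m - 1), which
is at most C(n, m).  This form of the inequalities does not depend on the parity
of m. *)
Lemma bonferroni (n m : nat) :
  `|(n == 0)%:R - \sum_(r < m) (-1) ^+ r * 'C(n, r)%:R| <= 'C(n, m)%:R :> R.
Proof.
case: m => [|m]; first by rewrite big_ord0 subr0 bin0; case: (n == 0)%N; rewrite ?normr1 ?normr0.
case: n => [|n].
  rewrite big_ord_recl /= big1 ?bin0 ?expr0 ?mulr1 ?addr0 ?subrr ?normr0 //.
  by move=> i _; rewrite bin0n mulr0.
rewrite alternating_binomial sub0r normrN normrM normrX normrN1 expr1n mul1r.
by rewrite ger0_norm // ler_nat binS leq_addl.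
Qed.

Lemma prob_no_isolated p m : 0 <= p <= 1 ->
  `|prob G p (fun A => isolated_set G A == set0)
     - \sum_(r < m) (-1) ^+ r * isolation_sum (1 - p) r| <= isolation_sum (1 - p) m.
Proof.
move=> p01; rewrite -expect_binomial_isolated.
rewrite (eq_bigr (fun r : 'I_m => expect G p (fun A =>
    (-1) ^+ r * 'C(#|isolated_set G A|, r)%:R))); last first.
  by move=> r _; rewrite expectZ expect_binomial_isolated.
rewrite -expect_sum -expectB.
apply: le_trans (ler_norm_sum _ _ _) _; apply: ler_sum => A _.
rewrite normrM ger0_norm ?edge_weight_ge0 // ler_wpM2l ?edge_weight_ge0 //.
by rewrite -cards_eq0; exact: bonferroni.
Qed.
End FactorialMoments.

(** * A criterion for connectivity *)

(** The invariant along a walk in G from a good vertex x to z: all good vertices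
within distance one of z are linked to x.  When the walk moves from z to z', one
of z and z' is good and is already linked to x; a good vertex within distance
one of z' is then at distance at most two from it. *)
Lemma connected_from_good (V : finType) (G S : sgraph V) (good : pred V) :
  connected_graph G ->
  (forall x y, G x y -> good x || good y) ->
  (forall x w y, (x == w) || G x w -> (w == y) || G w y ->
     good x -> good y -> connect S x y) ->
  (forall x, exists2 y, G x y & S x y) ->
  connected_graph S.
Proof.
move=> /forallP Gconn cover link step.
have symS : connect_sym S by apply: sym_connect_sym => x y; exact: adj_sym.
have good_conn x y : good x -> good y -> connect S x y.
  move=> gx gy; suff inv z : connect G x z ->
      forall g, good g -> (z == g) || G z g -> connect S x g.
    by apply: (inv y) => //; [exact: (forallP (Gconn x)) | rewrite eqxx].
  move=> /connectP[s sP ->] {z gy}.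
  elim/last_ind: s sP => [|s z IHs] /=; first by move=> _ g gg xg; apply: (link x x); rewrite ?eqxx.
  rewrite rcons_path last_rcons => /andP[/IHs{}IHs zG] g gg zg.
  case/orP: (cover _ _ zG) => [gl|gz].
    apply: connect_trans (IHs _ gl _) _; first by rewrite eqxx.
    by apply: (link _ z) => //; rewrite zG orbT.
  apply: connect_trans (IHs z gz _) _; first by rewrite zG orbT.
  by apply: (link _ z); rewrite ?eqxx.
have near_good x : exists2 g, good g & connect S x g.
  have [gx|bx] := boolP (good x); first by exists x.
  have [y Gxy Sxy] := step x; exists y; last exact: connect1.
  by have := cover _ _ Gxy; rewrite (negPf bx).
apply/forallP => x; apply/forallP => y.
have [g gg xg] := near_good x; have [h gh yh] := near_good y.
by apply: connect_trans xg _; apply: connect_trans (good_conn _ _ gg gh) _; rewrite symS.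
Qed.

Lemma connect_first (V : finType) (S : sgraph V) x y :
  connect S x y -> x != y -> exists z, S x z.
Proof.
move=> /connectP[[|z s] /= sP ->]; first by rewrite eqxx.
by move=> _; case/andP: sP => Sxz _; exists z.
Qed.

(** * Cartesian powers *)

Section Base.
Variables (T : finType) (H : sgraph T).

Lemma degree_gt0 : (2 <= #|T|)%N -> connected_graph H -> forall t, (0 < degree H t)%N.
Proof.
move=> T2 /forallP Hc t.
have /card_gt0P[s] : (0 < #|predC1 t|)%N.
  by rewrite cardC1; case: #|T| T2 => [|[]].
rewrite inE eq_sym => ts; have [z tz] := connect_first (forallP (Hc t) s) ts.
by apply/card_gt0P; exists z; rewrite inE.
Qed.

Lemma degree_lt t : (degree H t < #|T|)%N.
Proof.
rewrite -cardsT; apply: proper_card; apply/properP; split; first exact: subsetT.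
by exists t; rewrite ?inE // adj_irrefl.
Qed.

Lemma deg_polyE (R : realType) (x : R) : deg_poly H x = \sum_t x ^+ degree H t.
Proof.
rewrite (partition_big (fun t => Ordinal (degree_lt t)) xpredT) //=.
apply: eq_bigr => i _; rewrite /ndeg mulr_natl -sumr_const; apply: eq_big.
  by move=> t; rewrite inE -val_eqE.
by move=> t; rewrite inE => /eqP ->.
Qed.
End Base.

Section Update.
Variables (T : finType) (n : nat).
Implicit Types (u v w : {ffun 'I_n -> T}).

Definition upd v i t : {ffun 'I_n -> T} := [ffun j => if j == i then t else v j].

Lemma updE v i t j : upd v i t j = if j == i then t else v j.
Proof. by rewrite ffunE. Qed.

Lemma updC v i j s t : i != j -> upd (upd v i s) j t = upd (upd v j t) i s.
Proof.
move=> ij; apply/ffunP => l; rewrite !updE.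
by case: eqP => // ->; rewrite eq_sym (negPf ij).
Qed.

Lemma upd_id v i : upd v i (v i) = v.
Proof. by apply/ffunP => l; rewrite updE; case: eqP => // ->. Qed.
End Update.

Section Power.
Variables (T : finType) (H : sgraph T) (n : nat).
Implicit Types (u v w : {ffun 'I_n -> T}).
Notation G := (cart_pow H n).

Lemma cart_updP v w :
  reflect (exists i t, H (v i) t /\ w = upd v i t) (G v w).
Proof.
apply: (iffP existsP) => [[i /andP[/forallP e Hi]]|[i [t [Ht ->]]]].
  exists i, (w i); split=> //; apply/ffunP => j; rewrite updE.
  by have := e j; case: eqP => [->//|_ /= /eqP].
exists i; rewrite updE eqxx Ht andbT; apply/forallP => j; apply/implyP => ji.
by rewrite updE (negPf ji).
Qed.

Lemma cart_upd v i t : H (v i) t -> G v (upd v i t).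
Proof. by move=> Ht; apply/cart_updP; exists i, t. Qed.

Lemma cart_eq_off v w : G v w -> exists i, forall j, j != i -> v j = w j.
Proof.
by move=> /cart_updP[i [t [_ ->]]]; exists i => j ji; rewrite updE (negPf ji).
Qed.

Lemma cart_upd_upd v w i t : G v w -> v i = w i -> G (upd v i t) (upd w i t).
Proof.
move=> /cart_updP[c [s [Hs ->]]]; rewrite updE; case: eqP => [-> e|/eqP ic _].
  by rewrite e adj_irrefl in Hs.
rewrite updC 1?eq_sym //; apply: cart_upd; rewrite updE eq_sym (negPf ic) //.
Qed.

Lemma degree_cart v : degree G v = (\sum_i degree H (v i))%N.
Proof.
rewrite /degree.
have -> : [set w | G v w] = [set upd v x.1 x.2 | x in [set x : 'I_n * T | H (v x.1) x.2]].
  apply/setP => w; rewrite inE; apply/cart_updP/imsetP => [[i [t [Ht ->]]]|[[i t]]].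
    by exists (i, t); rewrite ?inE.
  by rewrite inE => Ht ->; exists i, t.
rewrite card_in_imset => [|[i s] [j t]]; last first.
  rewrite !inE /= => Hs Ht eq_u; have := congr1 (fun f : {ffun _ -> _} => f i) eq_u.
  rewrite !updE eqxx; case: eqP => [ij ->|_ e]; first by rewrite ij.
  by rewrite e adj_irrefl in Hs.
rewrite -sum1_card (eq_bigl (fun x => xpredT x.1 && H (v x.1) x.2)); last by move=> x; rewrite inE.
rewrite -(pair_big_dep xpredT (fun i t => H (v i) t) (fun _ _ => 1%N)) /=.
by apply: eq_bigr => i _; rewrite -sum1_card; apply: eq_bigl => t; rewrite inE.
Qed.

Lemma degree_cart_bounds v : (forall t, 0 < degree H t)%N ->
  (n <= degree G v <= n * #|T|)%N.
Proof.
move=> Hpos; rewrite degree_cart; apply/andP; split.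
  by rewrite -[leqLHS]card_ord -sum1_card leq_sum.
rewrite -[X in (_ <= X * _)%N]card_ord -sum_nat_const leq_sum // => i _.
exact/ltnW/degree_lt.
Qed.

(** The expected number of isolated vertices is a sum of products over the
coordinates, hence a power. *)
Lemma sum_expr_degree_cart (R : realType) (x : R) :
  \sum_v x ^+ degree G v = deg_poly H x ^+ n.
Proof.
rewrite deg_polyE -[in RHS](card_ord n) -prodr_const bigA_distr_bigA /=.
by apply: eq_bigr => v _; rewrite degree_cart expr_sum.
Qed.

(** Change the coordinates of v into those of w one after the other, each along a
path of H. *)
Lemma cart_connected : connected_graph H -> connected_graph G.
Proof.
move=> /forallP Hc.
have step v i t : connect G v (upd v i t).
  have /connectP[s sP ->] := forallP (Hc (v i)) t.
  elim/last_ind: s sP => [|s z IHs] /=; first by rewrite upd_id.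
  rewrite rcons_path last_rcons => /andP[/IHs{}IHs Hz].
  apply: connect_trans IHs (connect1 _).
  apply/cart_updP; exists i, z; rewrite updE eqxx; split=> //.
  by apply/ffunP => j; rewrite !updE; case: eqP.
apply/forallP => v; apply/forallP => w.
suff h (s : seq 'I_n) : connect G v [ffun j => if j \in s then w j else v j].
  have := h (enum 'I_n); congr connect; apply/ffunP => j.
  by rewrite ffunE mem_enum.
elim: s => [|i s IHs].
  by have -> : [ffun j => if j \in [::] then w j else v j] = v by apply/ffunP => j; rewrite ffunE.
apply: connect_trans IHs _.
have -> : [ffun j => if j \in i :: s then w j else v j] =
  upd [ffun j => if j \in s then w j else v j] i (w i).
  by apply/ffunP => j; rewrite updE !ffunE inE; case: eqP => //= ->.
exact: step.
Qed.

Definition open_dirs (A : {set {set {ffun 'I_n -> T}}}) u : {set 'I_n} :=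
  [set i | [exists t, H (u i) t && ([set u; upd u i t] \in A)]].

(** An edge at u is determined by its direction and its new coordinate. *)
Lemma card_open_star A u : (#|star G u :&: A| <= #|open_dirs A u| * #|T|)%N.
Proof.
rewrite -cardsT -cardsX.
apply: leq_trans (leq_imset_card (fun x => [set u; upd u x.1 x.2]) (mem (setX (open_dirs A u) [set: T]))).
apply: subset_leq_card; apply/subsetP => e; rewrite inE starE => /andP[/imsetP[w]].
rewrite inE => /cart_updP[i [t [Ht ->]]] -> eA; apply/imsetP; exists (i, t) => //.
by rewrite !inE andbT /=; apply/existsP; exists t; rewrite Ht.
Qed.

End Power.

(** * Linking rich vertices *)

Lemma exists_subset_card (I : finType) (X : {set I}) a : (a <= #|X|)%N ->
  exists2 Y : {set I}, Y \subset X & #|Y| = a.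
Proof.
move=> /card_geqP[s [us ss sX]]; exists [set x in s].
  by apply/subsetP => x; rewrite inE => /sX.
by rewrite cardsE -ss; apply/card_uniqP.
Qed.

Section Blocks.
Variables (T : finType) (H : sgraph T) (n : nat).
Notation V := {ffun 'I_n -> T}.
Notation G := (cart_pow H n).
Variables (u w v : V) (g : V).

Definition shifted (x : V) i j : V := upd (upd x i (g i)) j (g j).

(** The inner edges of the path from u to v that first moves in direction i and
then in direction j, follows the walk u, w, v in the shifted position, and undoes
the moves.  Intersecting with the edge set discards the singletons that appear
when u = w or w = v. *)
Definition block (x : 'I_n * 'I_n) : {set {set V}} :=
  let: (i, j) := x in
  edges G :&: [set [set upd u i (g i); shifted u i j];
                   [set shifted u i j; shifted w i j];
                   [set shifted w i j; shifted v i j];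
                   [set shifted v i j; upd v j (g j)]].

Definition moving : {set 'I_n} := [set l | (u l != w l) || (w l != v l)].

(** Data for which the blocks of the pairs (i, j), with i in the first set and j
in the second, are disjoint and lead from u to v; [g] records the new value of
each shifted coordinate.  The two sets of directions are disjoint, so that a
single [g] serves both ends and the unordered pair {i, j} determines (i, j). *)
Definition linkable a (IJ : {set 'I_n} * {set 'I_n}) : bool :=
  let: (Iu, Jv) := IJ in
  [&& [disjoint Iu & Jv], [disjoint Iu & moving], [disjoint Jv & moving],
      a <= #|Iu|, a <= #|Jv|,
      [forall i in Iu, H (u i) (g i)] & [forall j in Jv, H (v j) (g j)]]%N.

(** The coordinates, apart from those in which the walk u, w, v moves, where some
vertex of e differs from u. *)
Definition trace (e : {set V}) : {set 'I_n} :=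
  \bigcup_(x in e) [set l | (l \notin moving) && (x l != u l)].

Lemma trace_pair x y : trace [set x; y] =
  [set l | (l \notin moving) && ((x l != u l) || (y l != u l))].
Proof.
rewrite /trace bigcup_setU !big_set1; apply/setP => l; rewrite !inE.
by rewrite andb_orr.
Qed.

Lemma notin_moving l : l \notin moving -> w l = u l /\ v l = u l.
Proof. by rewrite inE negb_or !negbK => /andP[/eqP -> /eqP ->]. Qed.

(** Every edge of the block has an end shifted in both directions i and j and no
end shifted in a third direction, the moving coordinates aside.  Its trace
therefore reveals the pair {i, j}, which makes distinct blocks disjoint. *)
Lemma trace_block i j e : i \notin moving -> j \notin moving -> i != j ->
  g i != u i -> g j != u j -> e \in block (i, j) -> trace e = [set i; j].
Proof.
move=> iD jD ij gi gj; have ji : (j == i) = false by rewrite eq_sym (negPf ij).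
rewrite in_setI => /andP[_]; rewrite !in_setU !in_set1.
move=> e4; have {e4} [x [y [-> {e} [ex ey]]]] : exists x y, e = [set x; y] /\
    ((x = shifted u i j \/ x = shifted w i j \/ x = shifted v i j) /\
     (y = upd u i (g i) \/ y = upd v j (g j) \/ y = shifted w i j \/ y = shifted v i j)).
  case/orP: e4 => [/orP[/orP[]|]|] /eqP ->.
  - by exists (shifted u i j), (upd u i (g i)); rewrite setUC; tauto.
  - by exists (shifted u i j), (shifted w i j); tauto.
  - by exists (shifted w i j), (shifted v i j); tauto.
  - by exists (shifted v i j), (upd v j (g j)); tauto.
rewrite trace_pair; apply/setP => l; rewrite in_set !in_set2.
have [lD|lD] /= := boolP (l \in moving).
  by apply/esym/negbTE; rewrite negb_or; apply/andP; split; apply: contraTneq lD => ->.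
have [wl vl] := notin_moving lD.
have -> : x l = if l == j then g j else if l == i then g i else u l.
  by case: ex => [->|[->|->]]; rewrite !updE ?wl ?vl.
have [->|lj] := eqVneq l j; first by rewrite gj orbT.
have [->|li] := eqVneq l i; first by rewrite gi.
rewrite eqxx /=; apply/negbTE; rewrite negbK; apply/eqP.
by case: ey => [->|[->|[->|->]]]; rewrite !updE ?(negPf lj) ?(negPf li) ?wl ?vl.
Qed.

Section Linkable.
Variables (a : nat) (I J : {set 'I_n}).
Hypothesis IJ : linkable a (I, J).

Lemma linkableP i j : i \in I -> j \in J ->
  [/\ i \notin moving, j \notin moving, i != j, H (u i) (g i) & H (v j) (g j)].
Proof.
case/and5P: IJ => dIJ dI dJ _ /and3P[_ /forall_inP gI /forall_inP gJ] iI jJ.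
rewrite gI ?gJ // (disjointFr dI iI) (disjointFr dJ jJ); split=> //.
by apply: contraTneq jJ => <-; rewrite (disjointFr dIJ iI).
Qed.

Lemma block_disjoint :
  {in setX I J &, forall x y, x != y -> [disjoint block x & block y]}.
Proof.
move=> [i j] [i' j']; rewrite !inE /= => /andP[iI jJ] /andP[iI' jJ'].
apply: contraNT; rewrite -setI_eq0 => /set0Pn[e /setIP[eB eB']].
have tr k l : k \in I -> l \in J -> e \in block (k, l) -> trace e = [set k; l].
  move=> kI lJ; have [kD lD kl Hk Hl] := linkableP kI lJ.
  apply: trace_block => //; first by rewrite eq_sym (adj_neq Hk).
  by have [_ <-] := notin_moving lD; rewrite eq_sym (adj_neq Hl).
have eq_ij : [set i; j] = [set i'; j'] by rewrite -!tr.
have : i \in [set i'; j'] by rewrite -eq_ij set21.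
have : j \in [set i'; j'] by rewrite -eq_ij set22.
have [_ _ ij' _ _] := linkableP iI jJ'; have [_ _ i'j _ _] := linkableP iI' jJ.
rewrite !inE (negPf ij') eq_sym (negPf i'j) orbF /= => /eqP-> /eqP->.
by rewrite eqxx.
Qed.

Lemma card_block x : (#|block x| <= 4)%N.
Proof.
case: x => i j; apply: leq_trans (subset_leq_card (subsetIr _ _)) _.
by rewrite -!setUA !cardsU1 cards1; do 3!case: (_ \notin _).
Qed.

(** At least a^2 disjoint blocks of at most four edges have to fail
independently. *)
Lemma prob_no_block_open (R : realType) (p : R) : 0 <= p <= 1 ->
  prob G p (fun A => [forall x in setX I J, ~~ (block x \subset A)])
  <= (1 - p ^+ 4) ^+ (a * a).
Proof.
move=> /andP[p0 p1].
have p4 : 0 <= 1 - p ^+ 4 <= 1.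
  by rewrite subr_ge0 exprn_ile1 //= gerBl exprn_ge0.
apply: (@le_trans _ _ (\prod_(x <- enum (setX I J)) (1 - p ^+ #|block x|))).
  have -> : \prod_(x <- enum (setX I J)) (1 - p ^+ #|block x|) =
      p ^+ #|set0 : {set {set V}}| * \prod_(x <- enum (setX I J)) (1 - p ^+ #|block x|).
    by rewrite cards0 mul1r.
  rewrite -(@prob_open_blocks _ _ G).
  - rewrite le_eqVlt; apply/orP; left; apply/eqP/eq_expect => A.
    rewrite sub0set mul1r big_enum /=.
    case: (boolP [forall x in setX I J, _]) => [/forall_inP h|].
      by rewrite big1 // => x /h ->.
    rewrite negb_forall_in => /exists_inP[x xIJ /negPf bx].
    by rewrite (bigD1 x) //= bx mul0r.
  - exact: enum_uniq.
  - exact: sub0set.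
  - by move=> [i j] _; exact: subsetIl.
  - by move=> x _; rewrite -setI_eq0 set0I.
  - by move=> x y; rewrite !mem_enum; exact: block_disjoint.
rewrite big_enum /=; apply: (@le_trans _ _ (\prod_(x in setX I J) (1 - p ^+ 4))).
  apply: ler_prod => x _; rewrite subr_ge0 exprn_ile1 //=.
  by rewrite lerD2l lerN2 ler_wiXn2l ?card_block.
case/andP: p4 => p40 p41.
rewrite prodr_const ler_wiXn2l // cardsX.
by case/and5P: IJ => _ _ _ aI /and3P[aJ _ _]; exact: leq_mul.
Qed.

Lemma connect_of_open_block (A : {set {set V}}) i j :
  (u == w) || G u w -> (w == v) || G w v -> i \in I -> j \in J ->
  [set u; upd u i (g i)] \in A -> [set v; upd v j (g j)] \in A ->
  block (i, j) \subset A -> connect (spanning_subgraph G A) u v.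
Proof.
move=> uw wv iI jJ eu ev sBA; have [iD jD ij Hi Hj] := linkableP iI jJ.
have [wi vi] := notin_moving iD; have [wj vj] := notin_moving jD.
have ji : (j == i) = false by rewrite eq_sym (negPf ij).
have hop x y : (x == y) || G x y -> (G x y -> [set x; y] \in A) ->
    connect (spanning_subgraph G A) x y.
  case/orP=> [/eqP-> _|Gxy /(_ Gxy) eA]; first exact: connect0.
  by apply: connect1; rewrite /= /spanning_rel Gxy.
have inB x y : G x y -> [set x; y] \in [set [set upd u i (g i); shifted u i j];
    [set shifted u i j; shifted w i j]; [set shifted w i j; shifted v i j];
    [set shifted v i j; upd v j (g j)]] -> [set x; y] \in A.
  by move=> Gxy e4; apply: (subsetP sBA); rewrite in_setI edges_pair Gxy.
have shift (x y : V) : x i = y i -> x j = y j -> (x == y) || G x y ->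
    (shifted x i j == shifted y i j) || G (shifted x i j) (shifted y i j).
  move=> xi xj /orP[/eqP->|Gxy]; first by rewrite eqxx.
  by rewrite !cart_upd_upd ?orbT // !updE ji.
apply: connect_trans (hop u (upd u i (g i)) _ (fun _ => eu)) _.
  by rewrite cart_upd ?orbT.
apply: connect_trans (hop _ (shifted u i j) _ _) _.
- by rewrite cart_upd ?orbT // updE ji -vj.
- by move=> /inB; apply; rewrite !inE eqxx.
apply: connect_trans (hop _ (shifted w i j) _ _) _.
- by apply: shift; rewrite ?wi ?wj.
- by move=> /inB; apply; rewrite !inE eqxx ?orbT.
apply: connect_trans (hop _ (shifted v i j) _ _) _.
- by apply: shift; rewrite ?wi ?wj ?vi ?vj.
- by move=> /inB; apply; rewrite !inE eqxx ?orbT.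
apply: connect_trans (hop _ (upd v j (g j)) _ _) _.
- rewrite /shifted updC // adj_sym cart_upd ?orbT //.
  by rewrite updE (negPf ij) vi.
- by move=> /inB; apply; rewrite !inE eqxx ?orbT.
apply: hop; first by rewrite adj_sym cart_upd ?orbT.
by rewrite setUC.
Qed.
End Linkable.

Lemma card_moving : (u == w) || G u w -> (w == v) || G w v -> (#|moving| <= 2)%N.
Proof.
have diff1 (x y : V) : (x == y) || G x y -> (#|[set l | x l != y l]| <= 1)%N.
  case/orP => [/eqP->|/cart_eq_off[i xy]].
    by rewrite eq_card0 // => l; rewrite !inE eqxx.
  rewrite -(cards1 i) subset_leq_card //; apply/subsetP => l; rewrite !inE.
  by apply: contraR => /xy ->.
move=> /diff1 uw /diff1 wv; have -> : moving = [set l | u l != w l] :|: [set l | w l != v l].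
  by apply/setP => l; rewrite !inE.
exact: leq_trans (leq_card_setU _ _) (leq_add uw wv).
Qed.
End Blocks.

Section Linking.
Variables (T : finType) (H : sgraph T) (n : nat).
Notation V := {ffun 'I_n -> T}.
Notation G := (cart_pow H n).

(** Of the 2 (a + 1) open directions at each end, at most two are lost to the
walk u, w, v.  Take a of the remaining ones at u for the first set; then at least
a of those at v are left for the second set. *)
Lemma unlinked_blocks (A : {set {set V}}) (u w v : V) a :
  (u == w) || G u w -> (w == v) || G w v ->
  (a.+1.*2 <= #|open_dirs H A u|)%N -> (a.+1.*2 <= #|open_dirs H A v|)%N ->
  ~~ connect (spanning_subgraph G A) u v ->
  exists g IJ, linkable H u w v g a IJ &&
    [forall x in setX IJ.1 IJ.2, ~~ (block H u w v g x \subset A)].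
Proof.
move=> uw wv gu gv; set D := moving u w v.
have cD : (#|D| <= 2)%N := card_moving uw wv.
have [I sI cI] : exists2 I : {set 'I_n}, I \subset open_dirs H A u :\: D & #|I| = a.
  apply: exists_subset_card; rewrite cardsD.
  have := subset_leq_card (subsetIr (open_dirs H A u) D).
  by move: gu cD; lia.
set J := (open_dirs H A v :\: D) :\: I.
have cJ : (a <= #|J|)%N.
  rewrite !cardsD.
  have := subset_leq_card (subsetIr (open_dirs H A v :\: D) I).
  have := subset_leq_card (subsetIr (open_dirs H A v) D).
  by move: gv cD; rewrite cI; lia.
pose tgt (x : V) i := odflt (x i) [pick t | H (x i) t && ([set x; upd x i t] \in A)].
have tgtP x i : i \in open_dirs H A x ->
    H (x i) (tgt x i) /\ [set x; upd x i (tgt x i)] \in A.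
  rewrite inE /tgt => /existsP[t ht]; case: pickP => [s /andP[]//|/(_ t)].
  by rewrite ht.
pose g := [ffun i => if i \in I then tgt u i else tgt v i] : V.
have gI i : i \in I -> H (u i) (g i) /\ [set u; upd u i (g i)] \in A.
  by move=> iI; rewrite ffunE iI; apply: tgtP; have := subsetP sI _ iI; rewrite !inE => /andP[].
have gJ j : j \in J -> H (v j) (g j) /\ [set v; upd v j (g j)] \in A.
  rewrite ffunE !in_setD => /and3P[/negPf-> _ jO].
  exact: tgtP.
have lk : linkable H u w v g a (I, J).
  apply/and5P; split; rewrite ?cI //.
  - by rewrite -setI_eq0; apply/eqP/setP => i; rewrite !inE; case: (i \in I).
  - rewrite -setI_eq0 -subset0; apply/subsetP => i /setIP[/(subsetP sI)].
    by rewrite in_setD => /andP[/negPf->].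
  - rewrite -setI_eq0 -subset0; apply/subsetP => i /setIP[].
    by rewrite !in_setD => /and3P[_ /negPf->].
  - by apply/and3P; split=> //; apply/forall_inP => i; [move=> /gI[] | move=> /gJ[]].
move=> nconn; exists g, (I, J); rewrite lk /=; apply/forall_inP => -[i j].
rewrite in_setX => /andP[iI jJ]; apply: contra nconn => sB.
by apply: (connect_of_open_block lk uw wv iI jJ); [exact: (gI i iI).2 | exact: (gJ j jJ).2 |].
Qed.

Definition has_unlinked a (A : {set {set V}}) : bool :=
  [exists x : V * V * V, let: (u, w, v) := x in
    [&& (u == w) || G u w, (w == v) || G w v,
        (a.+1.*2 <= #|open_dirs H A u|)%N, (a.+1.*2 <= #|open_dirs H A v|)%N
      & ~~ connect (spanning_subgraph G A) u v]].

(** The union bound ranges over u, w, v, the values g and two sets of directions,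
which are (k^4 * 4)^n choices. *)
Lemma prob_has_unlinked (R : realType) (p : R) a : 0 <= p <= 1 ->
  prob G p (has_unlinked a) <=
  ((#|T| ^ 4 * 4) ^ n)%:R * (1 - p ^+ 4) ^+ (a * a).
Proof.
move=> p01.
pose K : finType := (V * V * V * V * ({set 'I_n} * {set 'I_n}))%type.
pose P (x : K) := let: (u, w, v, g, IJ) := x in linkable H u w v g a IJ.
pose Q (x : K) (A : {set {set V}}) := let: (u, w, v, g, IJ) := x in
   [forall y in setX IJ.1 IJ.2, ~~ (block H u w v g y \subset A)].
apply: (@le_trans _ _ (prob G p (fun A => [exists x, P x && Q x A]))).
  apply: le_prob => // A /existsP[[[u w] v] /and5P[uw wv gu gv nc]].
  have [g [IJ h]] := unlinked_blocks uw wv gu gv nc.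
  by apply/existsP; exists (u, w, v, g, IJ).
apply: le_trans (prob_exists _ p01 _ _) _.
apply: (@le_trans _ _ (\sum_(x | P x) (1 - p ^+ 4) ^+ (a * a))).
  apply: ler_sum => -[[[[u w] v] g] [I J]] lk; exact: prob_no_block_open.
case/andP: p01 => p0 p1.
rewrite sumr_const -[leLHS]mulr_natl ler_wpM2r ?exprn_ge0 ?subr_ge0 ?exprn_ile1 // ler_nat.
apply: leq_trans (max_card _) _.
have card_sets : #|{: {set 'I_n}}| = (2 ^ n)%N.
  by rewrite -cardsT -powersetT card_powerset cardsT card_ord.
rewrite !card_prod !card_ffun !card_ord card_sets.
rewrite -!expnMn leq_eqVlt; apply/orP; left; apply/eqP; congr (_ ^ _)%N.
by rewrite !expnS expn0 muln1 !mulnA -mulnA.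
Qed.
End Linking.

(** * Poor pairs and the comparison with isolated vertices *)

Section Comparison.
Variables (T : finType) (H : sgraph T) (n : nat).
Notation V := {ffun 'I_n -> T}.
Notation G := (cart_pow H n).
Hypotheses (H2 : (2 <= #|T|)%N) (Hconn : connected_graph H) (n_gt0 : (0 < n)%N).

Definition has_poor_pair a (A : {set {set V}}) : bool :=
  [exists x : V * V, [&& G x.1 x.2, (#|open_dirs H A x.1| < a.+1.*2)%N
                       & (#|open_dirs H A x.2| < a.+1.*2)%N]].

(** The stars of two adjacent poor vertices contain at most 4 k (a + 1) open edges
together.  The Chernoff bound gives s^(deg u + deg v - 1) up to the power of
theta; the factor s^(deg u) sums to P(H, s)^n over u and deg v is at least n. *)
Lemma prob_has_poor_pair (R : realType) (p theta : R) a :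
  0 <= p <= 1 -> 0 < theta <= 1 ->
  let s := 1 - p + p * theta in
  prob G p (has_poor_pair a) <=
  theta^-1 ^+ (a.+1 * (4 * #|T|)) * ((n * #|T|)%:R * (s ^+ n.-1 * deg_poly H s ^+ n)).
Proof.
move=> p01 t01; set s := 1 - p + p * theta => /=.
have /andP[p0 p1] := p01; have /andP[t0 t1] := t01.
have s0 : 0 <= s by rewrite addr_ge0 ?subr_ge0 // mulr_ge0 // ltW.
have s1 : s <= 1 by rewrite -lerBrDl opprB addrC subrK ler_piMr.
have Hdeg := degree_gt0 H2 Hconn.
pose K : finType := (V * ('I_n * T))%type.
pose P (x : K) := H (x.1 x.2.1) x.2.2.
pose Q (x : K) (A : {set {set V}}) :=
  (#|(star G x.1 :|: star G (upd x.1 x.2.1 x.2.2)) :&: A| <= a.+1 * (4 * #|T|))%N.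
apply: (@le_trans _ _ (prob G p (fun A => [exists x, P x && Q x A]))).
  apply: le_prob => // A /existsP[[u v] /= /and3P[/cart_updP[i [t [Ht ->]]] pu pv]].
  apply/existsP; exists (u, (i, t)); rewrite /P /= Ht /Q /= setIUl.
  apply: leq_trans (leq_card_setU _ _) _.
  have poor x : (#|open_dirs H A x| < a.+1.*2)%N ->
      (#|star G x :&: A| <= a.+1 * (2 * #|T|))%N.
    move=> px; apply: leq_trans (card_open_star H A x) _.
    by rewrite mulnA leq_mul2r muln2 (ltnW px) orbT.
  have -> : (4 * #|T| = 2 * #|T| + 2 * #|T|)%N by rewrite -mulnDl.
  by rewrite mulnDr leq_add ?poor.
apply: le_trans (prob_exists _ p01 _ _) _.
apply: (@le_trans _ _ (\sum_(x : K) theta^-1 ^+ (a.+1 * (4 * #|T|)) *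
    (s ^+ n.-1 * s ^+ degree G x.1))).
  rewrite big_mkcond /=; apply: ler_sum => -[u [i t]] _; rewrite /P /Q /=.
  have rhs_ge0 : 0 <= theta^-1 ^+ (a.+1 * (4 * #|T|)).
    by rewrite exprn_ge0 // invr_ge0 ltW.
  case: ifP => [Ht|_]; last by apply: mulr_ge0 => //; rewrite mulr_ge0 ?exprn_ge0.
  have Guv := cart_upd Ht.
  apply: le_trans (prob_few_open p01 _ _ t01) _.
    by rewrite subUset !star_edges.
  rewrite ler_wpM2l // -exprD ler_wiXn2l //.
  apply: leq_trans _ (card_starU _ (adj_neq Guv)).
  have /andP[dv _] := degree_cart_bounds (upd u i t) Hdeg.
  rewrite -[(_ + _).-1]subn1 -addnBA ?(leq_trans n_gt0) // subn1 addnC leq_add2l.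
  by rewrite -!subn1 leq_sub2r.
rewrite -mulr_sumr; apply: ler_wpM2l; first by rewrite exprn_ge0 // invr_ge0 ltW.
rewrite -(pair_bigA _ (fun (u : V) (_ : 'I_n * T) => s ^+ n.-1 * s ^+ degree G u)) /=.
rewrite (eq_bigr (fun u => (n * #|T|)%:R * s ^+ n.-1 * s ^+ degree G u)); last first.
  by move=> u _; rewrite sumr_const card_prod card_ord -mulrA mulr_natl.
by rewrite -mulr_sumr sum_expr_degree_cart mulrA.
Qed.

Lemma connected_no_isolated (A : {set {set V}}) :
  connected_graph (spanning_subgraph G A) -> isolated_set G A = set0.
Proof.
move=> /forallP Gc; apply/setP => v; rewrite in_set0; apply/negP => vA.
have /andP[dv _] := degree_cart_bounds v (degree_gt0 H2 Hconn).
have /card_gt0P[w] : (0 < degree G v)%N := leq_trans n_gt0 dv.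
rewrite inE => /adj_neq vw.
have [z /= /andP[Gvz zA]] := connect_first (forallP (Gc v) w) vw.
move: vA; rewrite inE => /disjointFr/(_ (_ : [set v; z] \in star G v)).
by rewrite zA => /(_ _)/negP; apply; rewrite // inE edges_pair Gvz set21.
Qed.

Lemma connected_of_no_defect a (A : {set {set V}}) :
  isolated_set G A = set0 -> ~~ has_poor_pair a A -> ~~ has_unlinked H a A ->
  connected_graph (spanning_subgraph G A).
Proof.
move=> iso0 /existsPn poor /existsPn unl.
apply: (@connected_from_good _ G _ (fun u => a.+1.*2 <= #|open_dirs H A u|)%N).
- exact: cart_connected.
- move=> x y Gxy.
  have : ~~ [&& G x y, (#|open_dirs H A x| < a.+1.*2)%N & (#|open_dirs H A y| < a.+1.*2)%N]
    := poor (x, y).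
  by rewrite Gxy andTb negb_and -!leqNgt.
- move=> x w y xw wy gx gy; have := unl (x, w, y).
  by rewrite xw wy gx gy negbK.
- by move=> x; apply: isolatedPn; rewrite iso0 in_set0.
Qed.

Lemma connected_approx (R : realType) (p : R) a : 0 <= p <= 1 ->
  `|perc_prob G p (@connected_graph _) - prob G p (fun A => isolated_set G A == set0)|
  <= prob G p (has_poor_pair a) + prob G p (has_unlinked H a).
Proof.
move=> p01; rewrite perc_probE -expectB -[leRHS]big_split /=.
apply: le_trans (ler_norm_sum _ _ _) _; apply: ler_sum => A _.
rewrite normrM ger0_norm ?edge_weight_ge0 // -mulrDr ler_wpM2l ?edge_weight_ge0 //.
have [Ac|Ac] /= := boolP (connected_graph _).
  by rewrite connected_no_isolated // eqxx subrr normr0 addr_ge0.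
rewrite sub0r normrN normr_nat -natrD ler_nat.
case: eqP => // iso0; case: (boolP (has_poor_pair a A)) => // np.
case: (boolP (has_unlinked H a A)) => // nu.
by rewrite (connected_of_no_defect iso0 np nu) in Ac.
Qed.
End Comparison.

(** * The degree polynomial *)

Section DegreePolynomial.
Variables (R : realType) (T : finType) (H : sgraph T).
Hypotheses (H2 : (2 <= #|T|)%N) (Hconn : connected_graph H).
Implicit Types x y : R.
Let Hdeg := degree_gt0 H2 Hconn.

Lemma deg_poly_mono : {in Num.nneg &, {mono @deg_poly R T H : x y / x <= y}}.
Proof.
apply: le_mono_in => x y; rewrite !nnegrE => x0 y0 xy; rewrite !deg_polyE.
have /card_gt0P[t _] : (0 < #|T|)%N by apply: leq_trans H2.
rewrite (bigD1 t) //= [ltRHS](bigD1 t) //=; apply: ltr_leD.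
  by rewrite ltrXn2r // -lt0n.
by apply: ler_sum => s _; rewrite lerXn2r // ltW.
Qed.

Lemma deg_poly1 : deg_poly H (1 : R) = #|T|%:R.
Proof.
by rewrite deg_polyE (eq_bigr (fun=> 1)) ?sumr_const // => t _; rewrite expr1n.
Qed.

Lemma deg_poly_solve y : 0 < y -> exists x, 0 < x /\ deg_poly H x = y.
Proof.
move=> y0; pose P : {poly R} := \sum_t 'X^(degree H t) - y%:P.
have PE x : P.[x] = deg_poly H x - y.
  rewrite deg_polyE hornerD hornerN hornerC horner_sum; congr (_ - _).
  by apply: eq_bigr => t _; rewrite hornerXn.
have P0 : P.[0] = - y.
  rewrite PE deg_polyE big1 ?add0r // => t _.
  by rewrite expr0n eqn0Ngt Hdeg.
(* At 1 + y, which is at least 1, a single monomial already exceeds y. *)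
have [||x] := @poly_ivt R P 0 (1 + y); first by rewrite addr_ge0 // ltW.
  rewrite P0 oppr_le0 (ltW y0) PE subr_ge0 deg_polyE /=.
  have /card_gt0P[t _] : (0 < #|T|)%N by apply: leq_trans H2.
  have y1 : 1 <= 1 + y by rewrite lerDl ltW.
  rewrite (bigD1 t) //= -[leLHS]addr0 lerD //; last first.
    by apply: sumr_ge0 => s _; rewrite exprn_ge0 // addr_ge0 // ltW.
  apply: (@le_trans _ _ (1 + y)); first by rewrite lerDr.
  by rewrite -[leLHS]expr1 ler_weXn2l.
move=> /andP[x0 _] /rootP Px; exists x; split; last by move: Px; rewrite PE => /subr0_eq.
rewrite lt_neqAle x0 andbT; apply: contra_eq_neq Px => <-.
by rewrite P0 oppr_eq0 gt_eqF.
Qed.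

(** Solutions of P(H, x) = y with y slightly above 1 stay below the solution x of
P(H, x) = 3/2, which is less than 1 because P(H, 1) >= 2.  Taking y below
(1 + 1/x)/2 gives s0 y <= (x + 1)/2 < 1. *)
Lemma deg_poly_window : exists s1 s0 : R,
  [/\ 0 < s1, s1 < s0, s0 < 1, 1 < deg_poly H s1 & s0 * deg_poly H s0 < 1].
Proof.
have mono x y : 0 < x -> 0 < y -> (deg_poly H x < deg_poly H y) = (x < y).
  move=> x0 y0; apply: (leW_mono_in deg_poly_mono); rewrite nnegrE; exact: ltW.
have [x [x0 Px]] := @deg_poly_solve (3 / 2) ltac:(lra).
have x1 : x < 1.
  rewrite -mono // deg_poly1 Px; have : (2 : R) <= #|T|%:R by rewrite ler_nat.
  by move: (#|T|%:R : R) => c; lra.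
have ix1 : 1 < x^-1 by rewrite invf_gt1.
pose y := Num.min (3 / 2) ((1 + x^-1) / 2).
have y1 : 1 < y by rewrite lt_min; apply/andP; split; lra.
have [s0 [s00 Ps0]] := @deg_poly_solve y ltac:(lra).
have [s1 [s10 Ps1]] := @deg_poly_solve ((1 + y) / 2) ltac:(lra).
have s0x : s0 <= x by rewrite leNgt -mono // -leNgt Ps0 Px ge_min lexx.
exists s1, s0; split=> //.
- by rewrite -mono // Ps0 Ps1; lra.
- exact: le_lt_trans s0x x1.
- by rewrite Ps1; lra.
rewrite Ps0; apply: (@le_lt_trans _ _ (x * ((1 + x^-1) / 2))).
  by rewrite ler_pM ?(ltW s00) //; [lra | rewrite ge_min lexx orbT].
rewrite mulrA mulrDr mulr1 divff ?gt_eqF //; lra.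
Qed.
End DegreePolynomial.

From mathcomp Require Import all_classical all_reals all_analysis.

Import numFieldNormedType.Exports.
Local Open Scope classical_set_scope.

(** * Limits of sequences *)

Section Sequences.
Variable R : realType.
Implicit Types (n M : nat).

Lemma cvg_squeeze0 (f g : nat -> R) :
  (\forall n \near \oo, 0 <= f n <= g n) -> g n @[n --> \oo] --> 0 ->
  f n @[n --> \oo] --> 0.
Proof. by move=> fg g0; apply: (squeeze_cvgr fg) g0; exact: cvg_cst. Qed.

(** n r^n is at most the geometric sum of the r^i with i < n, because r^n <= r^i. *)
Lemma natr_mul_expr_le n (r : R) : 0 <= r <= 1 -> n%:R * r ^+ n * (1 - r) <= 1 - r ^+ n.
Proof.
move=> /andP[r0 r1]; elim: n => [|n IHn]; first by rewrite !mul0r expr0 subrr.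
have rn0 : 0 <= r ^+ n by rewrite exprn_ge0.
have rn1 : r ^+ n <= 1 by rewrite exprn_ile1.
have : r * (n%:R * r ^+ n * (1 - r)) <= r * (1 - r ^+ n) by rewrite ler_wpM2l.
rewrite -natr1 exprS; move: (n%:R : R) (r ^+ n) rn0 rn1 => c z z0 z1 {IHn} IH.
have : 0 <= (1 - r) * (1 - r * z) by rewrite mulr_ge0 ?subr_ge0 ?mulr_ile1.
by move: IH; clear; nra.
Qed.

Lemma cvg_natr_mul_expr (r : R) : 0 <= r < 1 -> n%:R * r ^+ n @[n --> \oo] --> 0.
Proof.
move=> /andP[r0 r1]; pose s := Num.sqrt r.
have s0 : 0 <= s := sqrtr_ge0 r.
have s1 : s < 1 by rewrite -sqrtr1 ltr_sqrt.
have rs : r = s * s by rewrite -expr2 sqr_sqrtr.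
apply: (@cvg_squeeze0 _ (geometric (1 - s)^-1 s)); last first.
  by apply: cvg_geometric; rewrite ger0_norm.
near=> n; rewrite mulr_ge0 ?exprn_ge0 //= rs exprMn mulrA ler_wpM2r ?exprn_ge0 //.
rewrite -[leRHS]mul1r ler_pdivlMr ?subr_gt0 //.
apply: le_trans (natr_mul_expr_le n _) _; first by rewrite s0 ltW.
by rewrite gerBl exprn_ge0.
Unshelve. all: by end_near. Qed.

Lemma cvg_divn_oo M : (0 < M)%N -> (n %/ M)%N @[n --> \oo] --> \oo.
Proof.
move=> M0; apply/cvgnyPge => A; near=> n; rewrite leq_divRL //.
by near: n; exact: nbhs_infty_ge.
Unshelve. all: by end_near. Qed.

(** Choose M with c rho^(M/2) <= 1: then c^(n / M) is absorbed by half of the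
exponential decay, and the other half absorbs the factor n. *)
Lemma exists_slow_exponent (c rho : R) : 1 <= c -> 0 < rho < 1 ->
  exists2 M, (0 < M)%N &
    c ^+ (n %/ M) * (n%:R * rho ^+ n) @[n --> \oo] --> 0.
Proof.
move=> c1 /andP[rho0 rho1]; pose s := Num.sqrt rho.
have s0 : 0 < s by rewrite sqrtr_gt0.
have s1 : s < 1 by rewrite -sqrtr1 ltr_sqrt.
have rs : rho = s * s by rewrite -expr2 sqr_sqrtr // ltW.
have [M [M0 cM]] : exists M, (0 < M)%N /\ c * s ^+ M <= 1.
  have : geometric c s n @[n --> \oo] --> 0.
    by apply: cvg_geometric; rewrite ger0_norm // ltW.
  move=> /cvgr_lt/(_ 1 ltr01) ev.
  near \oo => M; exists M; split; first by near: M; exact: nbhs_infty_gt.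
  by apply/ltW; near: M.
exists M => //; apply: (@cvg_squeeze0 _ (fun n => n%:R * s ^+ n)); last first.
  by apply: cvg_natr_mul_expr; rewrite ltW.
near=> n; have sn0 : 0 <= s ^+ n by rewrite exprn_ge0 // ltW.
have c0 : 0 <= c := le_trans ler01 c1.
rewrite !mulr_ge0 ?exprn_ge0 ?(ltW rho0) //=.
rewrite mulrCA ler_wpM2l // rs exprMn mulrA -[leRHS]mul1r ler_wpM2r //.
apply: (@le_trans _ _ ((c * s ^+ M) ^+ (n %/ M))); last first.
  by rewrite exprn_ile1 // mulr_ge0 // exprn_ge0 // ltW.
rewrite exprMn -exprM ler_wpM2l ?exprn_ge0 // ler_wiXn2l ?(ltW s0) ?(ltW s1) //.
by rewrite mulnC leq_divM.
Unshelve. all: by end_near. Qed.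

(** Writing a for n / M, the term is at most c^M times the a-th power of
c^M z^a, and the latter tends to 0. *)
Lemma cvg_expr_square (c z : R) M : (0 < M)%N -> 1 <= c -> 0 <= z < 1 ->
  c ^+ n * z ^+ (n %/ M * (n %/ M)) @[n --> \oo] --> 0.
Proof.
move=> M0 c1 /andP[z0 z1]; have c0 : 0 <= c := le_trans ler01 c1.
have cM0 : 0 <= c ^+ M by rewrite exprn_ge0.
pose g a : R := c ^+ M * (2^-1) ^+ a.
apply: (@cvg_squeeze0 _ (g \o (divn^~ M))); last first.
  apply: (cvg_comp _ _ (cvg_divn_oo M0)).
  by apply: cvg_geometric; rewrite ger0_norm //; lra.
have ev : \forall a \near \oo, c ^+ M * z ^+ a < 2^-1.
  have : geometric (c ^+ M) z n @[n --> \oo] --> 0.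
    by apply: cvg_geometric; rewrite ger0_norm.
  by move=> /cvgr_lt/(_ 2^-1); apply; rewrite invr_gt0.
near=> n.
have key : c ^+ M * z ^+ (n %/ M) < 2^-1 by near: n; exact: (cvg_divn_oo M0 ev).
set a := (n %/ M)%N in key *.
rewrite mulr_ge0 ?exprn_ge0 //= /g -/a.
apply: (@le_trans _ _ (c ^+ (M * a.+1) * z ^+ (a * a))).
  by rewrite ler_wpM2r ?exprn_ge0 // ler_weXn2l // ltnW // mulnC ltn_ceil.
rewrite mulnS exprD -mulrA ler_wpM2l // !exprM -exprMn lerXn2r ?nnegrE //.
- by rewrite mulr_ge0 // exprn_ge0.
- exact: ltW.
Unshelve. all: by end_near. Qed.

(** The bound S m n tends to l^m / m!, a term of a convergent series, and the
alternating sums tend to the partial sums of the exponential series; so fix m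
large and let n grow. *)
Lemma cvg_bonferroni (a : nat -> R) (S : nat -> nat -> R) (l : R) :
  (forall r, S r n @[n --> \oo] --> l ^+ r / r`!%:R) ->
  (forall m, \forall n \near \oo,
     `|a n - \sum_(r < m) (-1) ^+ r * S r n| <= S m n) ->
  a n @[n --> \oo] --> expR (- l).
Proof.
move=> Sl bnd; apply/cvgrPdist_lt => e e0.
have e3 : 0 < e / 3 by lra.
have serE m : series (exp_coeff (- l)) m = \sum_(r < m) (-1) ^+ r * (l ^+ r / r`!%:R).
  rewrite /series /= big_mkord; apply: eq_bigr => i _.
  by rewrite /exp_coeff /= mulrA -exprMn mulN1r.
have ser : series (exp_coeff (- l)) n @[n --> \oo] --> expR (- l).
  exact: is_cvg_series_exp_coeff.
have coef : exp_coeff l n @[n --> \oo] --> 0.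
  exact: cvg_series_cvg_0 (is_cvg_series_exp_coeff l).
have [m [m1 m2]] : exists m, `|expR (- l) - series (exp_coeff (- l)) m| < e / 3 /\
    l ^+ m / m`!%:R < e / 3.
  near \oo => m; exists m; split.
    by near: m; move/cvgrPdist_lt: ser => /(_ _ e3).
  by near: m; move/cvgr_lt: coef => /(_ _ e3).
have Ssum : \sum_(r < m) (-1) ^+ r * S r n @[n --> \oo] -->
    \sum_(r < m) (-1) ^+ r * (l ^+ r / r`!%:R).
  apply: cvg_big => [|r _]; first exact: add_continuous.
  by apply: cvgM; [exact: cvg_cst | exact: Sl].
near=> n.
have h1 : `|a n - \sum_(r < m) (-1) ^+ r * S r n| <= S m n by near: n; exact: bnd.
have h2 : S m n < e / 3 by near: n; move/cvgr_lt: (Sl m) => /(_ _ m2).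
have h3 : `|\sum_(r < m) (-1) ^+ r * (l ^+ r / r`!%:R)
           - \sum_(r < m) (-1) ^+ r * S r n| < e / 3.
  by near: n; move/cvgrPdist_lt: Ssum => /(_ _ e3).
move: m1 h1 h2 h3; rewrite serE.
move: (\sum_(r < m) _) (\sum_(r < m) _) (expR _) (a n) (S m n) => X Y Z W U.
rewrite !ltr_norml ler_norml => /andP[? ?] /andP[? ?] ? /andP[? ?].
by apply/andP; split; lra.
Unshelve. all: by end_near. Qed.
End Sequences.

(** * Convergence of the probability of connectivity *)

Section Limit.
Variables (R : realType) (T : finType) (H : sgraph T).
Hypotheses (H2 : (2 <= #|T|)%N) (Hconn : connected_graph H).
Variables (q : nat -> R) (l s1 : R).
Hypotheses (s1_gt0 : 0 < s1) (s1_lt1 : s1 < 1).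
Hypothesis q_bnd : \forall n \near \oo, 0 < q n <= s1.
Hypothesis lam_cvg : deg_poly H (q n) ^+ n @[n --> \oo] --> l.
Let Hdeg := degree_gt0 H2 Hconn.

(** By [isolation_sum_step], (r + 1) S_(r+1) differs from lambda_n S_r by at most S_r
times an exponentially small factor, so the limits satisfy the recursion of
l^r / r!. *)
Lemma cvg_isolation_sum r :
  isolation_sum (cart_pow H n) (q n) r @[n --> \oo] --> l ^+ r / r`!%:R.
Proof.
elim: r => [|r IHr].
  rewrite (@eq_cvg _ _ _ _ (fun=> 1)); last by move=> n; rewrite isolation_sum0.
  by rewrite expr0 fact0 divr1; exact: cvg_cst.
pose lamn n := deg_poly H (q n) ^+ n.
pose S k n := isolation_sum (cart_pow H n) (q n) k.
pose d n := r.+1%:R * S r.+1 n - lamn n * S r n.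
have err0 : (r + r * #|T|)%:R * s1 ^- r * (n%:R * s1 ^+ n) @[n --> \oo] --> 0.
  rewrite -[0 in X in _ --> X](mulr0 ((r + r * #|T|)%:R * s1 ^- r)).
  by apply: cvgM; [exact: cvg_cst | apply: cvg_natr_mul_expr; rewrite ltW].
have d0 : d n @[n --> \oo] --> 0.
  apply: norm_cvg0; apply: (@cvg_squeeze0 _ _ (fun n =>
      S r n * ((r + r * #|T|)%:R * s1 ^- r * (n%:R * s1 ^+ n)))); last first.
    by rewrite -[0 in X in _ --> X](mulr0 (l ^+ r / r`!%:R)); exact: cvgM.
  near=> n; rewrite normr_ge0 /=.
  have /andP[q0 q1] : 0 < q n <= s1 by near: n.
  have rn : (r < n)%N by near: n; exact: nbhs_infty_gt.
  have q01 : 0 <= q n <= 1 by rewrite ltW //= (le_trans q1) // ltW.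
  have := isolation_sum_step r q01 (fun v : {ffun 'I_n -> T} => degree_cart_bounds v Hdeg).
  rewrite sum_expr_degree_cart => /le_trans; apply.
  rewrite ler_wpM2l //; first by apply: sumr_ge0 => B _; rewrite exprn_ge0 // ltW.
  have -> : s1 ^+ n = s1 ^+ r * s1 ^+ (n - r) by rewrite -exprD subnKC // ltnW.
  have sr : s1 ^- r * s1 ^+ r = 1 by rewrite mulVf // expf_neq0 // gt_eqF.
  have -> : (r + r * #|T|)%:R * s1 ^- r * (n%:R * (s1 ^+ r * s1 ^+ (n - r))) =
      ((r + r * #|T|) * n)%:R * s1 ^+ (n - r).
    rewrite natrM -!mulrA; congr (_ * _).
    by rewrite mulrCA [X in _ * X]mulrA sr mul1r.
  apply: ler_pM; rewrite ?ler0n ?exprn_ge0 ?(ltW q0) //.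
    by rewrite ler_nat mulnDl leq_add ?leq_pmulr ?(leq_ltn_trans _ rn) // mulnAC mulnA.
  by rewrite lerXn2r // nnegrE ltW.
have -> : l ^+ r.+1 / r.+1`!%:R = r.+1%:R^-1 * (0 + l * (l ^+ r / r`!%:R)).
  rewrite factS natrM invfM add0r exprS.
  by move: (l ^+ r) (r.+1%:R^-1) (r`!%:R^-1) => x y z; ring.
rewrite (@eq_cvg _ _ _ _ (fun n => r.+1%:R^-1 * (d n + lamn n * S r n))); last first.
  by move=> n; rewrite /d subrK mulrA mulVf ?mul1r // pnatr_eq0.
by apply: cvgM; [exact: cvg_cst | apply: cvgD => //; exact: cvgM].
Unshelve. all: by end_near. Qed.

Lemma cvg_prob_no_isolated :
  prob (cart_pow H n) (1 - q n) (fun A => isolated_set (cart_pow H n) A == finset.set0)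
    @[n --> \oo] --> expR (- l).
Proof.
apply: cvg_bonferroni cvg_isolation_sum _ => m; near=> n.
have /andP[q0 q1] : 0 < q n <= s1 by near: n.
have := @prob_no_isolated R _ (cart_pow H n) (1 - q n) m.
rewrite subKr; apply; rewrite subr_ge0 gerBl (ltW q0) andbT.
by rewrite (le_trans q1) // ltW.
Unshelve. all: by end_near. Qed.

Variable s0 : R.
Hypotheses (s10 : s1 < s0) (s0_lt1 : s0 < 1) (s0P : s0 * deg_poly H s0 < 1).

(** With theta = s0 - s1 the quantity s of [prob_has_poor_pair] is at most s0, and
s0 P(H, s0) < 1 yields exponential decay; the power of theta is compensated by
choosing M large, that is, by calling poor only vertices with few open
directions. *)
Lemma cvg_prob_has_poor_pair : exists2 M, (0 < M)%N &
  prob (cart_pow H n) (1 - q n) (has_poor_pair H (n %/ M)) @[n --> \oo] --> 0.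
Proof.
have s0_gt0 : 0 < s0 := lt_trans s1_gt0 s10.
have P0 : 0 < deg_poly H s0.
  rewrite deg_polyE; have /card_gt0P[t _] : (0 < #|T|)%N by apply: leq_trans H2.
  rewrite (bigD1 t) //= ltr_pwDl ?exprn_gt0 //.
  by apply: sumr_ge0 => s _; rewrite exprn_ge0 // ltW.
pose theta := s0 - s1; pose c := theta^-1 ^+ (4 * #|T|).
have t01 : 0 < theta <= 1 by rewrite subr_gt0 s10 lerBlDr (le_trans (ltW s0_lt1)) // lerDl ltW.
have /andP[t0 t1] := t01.
have c1 : 1 <= c by rewrite exprn_ege1 // invf_ge1.
have rho01 : 0 < s0 * deg_poly H s0 < 1 by rewrite mulr_gt0.
have [M M0 Mcvg] := exists_slow_exponent c1 rho01; exists M => //.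
apply: (@cvg_squeeze0 _ _ (fun n => c * #|T|%:R * s0^-1 *
    (c ^+ (n %/ M) * (n%:R * (s0 * deg_poly H s0) ^+ n)))); last first.
  rewrite -[0 in X in _ --> X](mulr0 (c * #|T|%:R * s0^-1)).
  by apply: cvgM => //; exact: cvg_cst.
near=> n.
have /andP[q0 q1] : 0 < q n <= s1 by near: n.
have n0 : (0 < n)%N by near: n; exact: nbhs_infty_gt.
have p01 : 0 <= 1 - q n <= 1.
  by rewrite subr_ge0 gerBl (ltW q0) andbT (le_trans q1) // ltW.
rewrite prob_ge0 //=.
apply: le_trans (prob_has_poor_pair H2 Hconn n0 (n %/ M) p01 t01) _.
rewrite subKr; set s := q n + _.
have st0 : 0 <= s.
  by case/andP: p01 => p0 _; rewrite addr_ge0 ?mulr_ge0 ?(ltW q0) ?(ltW t0).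
have sle : s <= s0.
  have : (1 - q n) * theta <= theta by rewrite ler_piMl ?(ltW t0) //; case/andP: p01.
  by rewrite /s /theta; move: q1; lra.
have -> : theta^-1 ^+ ((n %/ M).+1 * (4 * #|T|)) = c * c ^+ (n %/ M).
  by rewrite mulnC exprM -exprS.
have Ple : deg_poly H s <= deg_poly H s0.
  by rewrite (deg_poly_mono H2) // nnegrE // ltW.
have Ps0 : 0 <= deg_poly H s.
  by rewrite deg_polyE sumr_ge0 // => t _; rewrite exprn_ge0.
have key : s ^+ n.-1 * deg_poly H s ^+ n <= s0^-1 * (s0 * deg_poly H s0) ^+ n.
  apply: (@le_trans _ _ (s0 ^+ n.-1 * deg_poly H s0 ^+ n)).
    by apply: ler_pM; rewrite ?exprn_ge0 // lerXn2r ?nnegrE // ltW.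
  have s0n : s0 ^+ n.-1 = s0^-1 * s0 ^+ n.
    by rewrite -[in RHS](prednK n0) exprS mulrA mulVf ?mul1r ?gt_eqF.
  by rewrite exprMn mulrA s0n.
have c0 : 0 <= c := le_trans ler01 c1.
apply: (@le_trans _ _ (c * c ^+ (n %/ M) * ((n * #|T|)%:R *
    (s0^-1 * (s0 * deg_poly H s0) ^+ n)))).
  apply: ler_wpM2l; last by rewrite ler_wpM2l.
  exact: mulr_ge0 c0 (exprn_ge0 _ c0).
rewrite natrM le_eqVlt; apply/orP; left; apply/eqP.
move: (c ^+ _) ((s0 * _) ^+ _) (s0^-1) (n%:R : R) (#|T|%:R : R) => x1 x2 x3 x4 x5.
by ring.
Unshelve. all: by end_near. Qed.

Lemma cvg_prob_has_unlinked M : (0 < M)%N ->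
  prob (cart_pow H n) (1 - q n) (has_unlinked H (n %/ M)) @[n --> \oo] --> 0.
Proof.
move=> M0; pose z := 1 - (1 - s1) ^+ 4.
have z01 : 0 <= z < 1.
  rewrite subr_ge0 exprn_ile1 ?subr_ge0 ?gerBl ?(ltW s1_gt0) ?(ltW s1_lt1) //=.
  by rewrite gtrBl exprn_gt0 // subr_gt0.
have c1 : 1 <= (#|T| ^ 4 * 4)%:R :> R.
  by rewrite ler1n muln_gt0 expn_gt0 (leq_trans _ H2).
apply: cvg_squeeze0 (cvg_expr_square M0 c1 z01).
near=> n.
have /andP[q0 q1] : 0 < q n <= s1 by near: n.
have p01 : 0 <= 1 - q n <= 1.
  by rewrite subr_ge0 gerBl (ltW q0) andbT (le_trans q1) // ltW.
rewrite prob_ge0 //=; apply: le_trans (prob_has_unlinked H n (n %/ M) p01) _.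
have /andP[p0 p1] := p01; have /andP[z0 _] := z01.
rewrite natrX ler_wpM2l ?exprn_ge0 // lerXn2r ?nnegrE //.
  by rewrite subr_ge0 exprn_ile1.
apply: lerB => //; apply: lerXn2r; rewrite ?nnegrE //; last exact: lerB.
by rewrite subr_ge0 ltW.
Unshelve. all: by end_near. Qed.

Lemma cvg_prob_connected :
  perc_prob (cart_pow H n) (1 - q n) (@connected_graph _) @[n --> \oo] --> expR (- l).
Proof.
have [M M0 poor0] := cvg_prob_has_poor_pair.
have unl0 := cvg_prob_has_unlinked M0.
pose f n := perc_prob (cart_pow H n) (1 - q n) (@connected_graph _).
pose g n := prob (cart_pow H n) (1 - q n) (fun A => isolated_set (cart_pow H n) A == finset.set0).
have fg0 : (f n - g n) @[n --> \oo] --> 0.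
  apply: norm_cvg0; apply: (@cvg_squeeze0 _ _ (fun n =>
    prob (cart_pow H n) (1 - q n) (has_poor_pair H (n %/ M)) +
    prob (cart_pow H n) (1 - q n) (has_unlinked H (n %/ M)))); last first.
    by rewrite -[0 in X in _ --> X](addr0 0); exact: cvgD.
  near=> n; rewrite normr_ge0 /=.
  have /andP[q0 q1] : 0 < q n <= s1 by near: n.
  apply: connected_approx => //; first by near: n; exact: nbhs_infty_gt.
  by rewrite subr_ge0 gerBl (ltW q0) andbT (le_trans q1) // ltW.
rewrite -[expR _]add0r (@eq_cvg _ _ _ _ (fun n => (f n - g n) + g n)); last first.
  by move=> n; rewrite subrK.
by apply: cvgD => //; exact: cvg_prob_no_isolated.
Unshelve. all: by end_near. Qed.
End Limit.

Theorem corollary2 (R : realType) (T : finType) (H : sgraph T)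
    (Hcard : (2 <= #|T|)%N) (Hconn : connected_graph H)
    (lam : nat -> R) (l : R)
    (lam_gt0 : forall n : nat, (1 <= n)%N -> 0 < lam n) (l_gt0 : 0 < l)
    (lam_cvg : lam n @[n --> \oo] --> l) :
  (forall n : nat, (1 <= n)%N ->
     exists! x : R, 0 < x /\ deg_poly H x = lam n `^ (n%:R^-1)) /\
  (forall q : nat -> R,
     (forall n : nat, (1 <= n)%N ->
        0 < q n /\ deg_poly H (q n) = lam n `^ (n%:R^-1)) ->
     (\forall n \near \oo, 0 < 1 - q n < 1) /\
     (perc_prob (cart_pow H n) (1 - q n) (@connected_graph _)
        @[n --> \oo] --> expR (- l))).
Proof.
have mono := @deg_poly_mono R _ _ Hcard Hconn.
split=> [n n1|q qP].
  have [x [x0 Px]] := deg_poly_solve Hcard Hconn (powR_gt0 n%:R^-1 (lam_gt0 n n1)).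
  exists x; split=> // y [y0 Py].
  by apply: (mono_inj_in lexx le_anti mono); rewrite ?nnegrE ?ltW // Px Py.
have [s1 [s0 [s1_gt0 s10 s0_lt1 Ps1 s0P]]] := deg_poly_window R Hcard Hconn.
have s1_lt1 : s1 < 1 := lt_trans s10 s0_lt1.
have lamE n : (1 <= n)%N -> deg_poly H (q n) ^+ n = lam n.
  move=> n1; have [_ ->] := qP n n1.
  rewrite -powR_mulrn ?powR_ge0 // -powRrM mulVf ?pnatr_eq0 -?lt0n //.
  by rewrite powRr1 // ltW // lam_gt0.
have q_bnd : \forall n \near \oo, 0 < q n <= s1.
  have small : geometric 1 (deg_poly H s1)^-1 n @[n --> \oo] --> 0.
    apply: cvg_geometric; rewrite ger0_norm ?invr_ge0 ?ltW ?(lt_trans _ Ps1) //.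
    by rewrite invf_lt1 // (lt_trans _ Ps1).
  (* If q n > s1 then lam n >= P(H, s1)^n, which exceeds the bounded sequence lam
     for large n, as P(H, s1) > 1. *)
  near=> n; have n1 : (1 <= n)%N by near: n; exact: nbhs_infty_gt.
  have [q0 _] := qP n n1; rewrite q0 leNgt; apply/negP => s1q.
  have lt_lam : lam n < l + 1 by near: n; move/cvgr_lt: lam_cvg; apply; rewrite ltrDl.
  have : geometric 1 (deg_poly H s1)^-1 n < (l + 1)^-1.
    by near: n; move/cvgr_lt: small; apply; rewrite invr_gt0 addr_gt0.
  rewrite /= mul1r exprVn ltf_pV2 ?posrE ?addr_gt0 ?exprn_gt0 ?(lt_trans _ Ps1) //.
  apply/negP; rewrite -leNgt; apply: le_trans (ltW lt_lam).
  rewrite -lamE // lerXn2r ?nnegrE ?(ltW (lt_trans ltr01 Ps1)) //.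
  - by rewrite deg_polyE sumr_ge0 // => t _; rewrite exprn_ge0 // ltW.
  - by rewrite mono ?nnegrE ltW.
split.
  near=> n; have /andP[q0 q1] : 0 < q n <= s1 by near: n.
  by rewrite subr_gt0 gtrBl q0 andbT (le_lt_trans q1).
apply: (cvg_prob_connected Hcard Hconn s1_gt0 s1_lt1 q_bnd _ s10 s0_lt1 s0P).
apply: cvg_trans lam_cvg; apply: near_eq_cvg; near=> n.
by rewrite lamE //; near: n; exact: nbhs_infty_gt.
Unshelve. all: by end_near. Qed.
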